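(* (1) There is a one-to-one correspondence between the equivalence classes of $d$-dimensional extremal matrices of order $n$ with deficiency $1$ and the Young diagrams with $n-1$ cells and at most $d$ rows. (2) A nonnegative $d\times n$ table $\Lambda=(\lambda_{i,j})$ is the optimal hyperplane cover of a $d$-dimensional extremal matrix of order $n$ with deficiency $\tfrac12$ if and only if all $\lambda_{i,j}\in\{0,\tfrac12,1\}$, the weight of $\Lambda$ equals $n-\tfrac12$, and for each row $i$ the number of entries equal to $\tfrac12$ in row $i$ is less than the total number of entries equal to $\tfrac12$ in all other rows.
   Context: A $d$-dimensional matrix of order $n$ is an array $(a_\alpha)_{\alpha\in\{1,\dots,n\}^d}$; $\mathrm{supp}(A)=\{\alpha:a_\alpha\ne0\}$; the hyperplane $\Gamma_{i,j}$ is the set of indices with $\alpha_i=j$. Two such matrices are equivalent if one can be obtained from the other by permuting hyperplanes of a single direction and by permuting the directions (coordinates). A polyplex of weight $W$ is a nonnegative matrix $K$ of order $n$ whose entries sum to at most $1$ over each hyperplane and to $W$ in total; a polydiagonal is a polyplex of weight $n$. A $(0,1)$-matrix $A$ contains $K$ if $\mathrm{supp}(K)\subseteq\mathrm{supp}(A)$. A hyperplane cover of $A$ is a nonnegative $d\times n$ table $\Lambda=(\lambda_{i,j})$ with $\sum_{i=1}^d\lambda_{i,\alpha_i}\ge1$ for all $\alpha\in\mathrm{supp}(A)$; its weight is the sum of its entries; it is optimal if it has minimum weight among hyperplane covers of $A$. A $(0,1)$-matrix $A$ is extremal if it contains no polydiagonal, but for every index $\alpha$ with $a_\alpha=0$ the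 matrix obtained by changing $a_\alpha$ to $1$ contains a polydiagonal. The deficiency of an extremal matrix of order $n$ is $n$ minus the maximum weight of a polyplex contained in it. *)

(* Defs.v *)
From mathcomp Require Import all_boot all_order all_algebra all_fingroup.
From mathcomp Require Import classical_sets functions reals.

Set Implicit Arguments.
Unset Strict Implicit.
Unset Printing Implicit Defensive.

Import Order.TTheory GRing.Theory Num.Theory.
Local Open Scope ring_scope.

Definition mdindex (d n : nat) := {ffun 'I_d -> 'I_n}.

(* d-dimensional matrices of order n with entries in T; the (0,1)-matrices are
   the ones with T = bool, true standing for the entry 1. *)
Definition mdmx (T : Type) (d n : nat) := {ffun mdindex d n -> T}.

(* The directions are permuted by t and then, in each direction i, the
   hyperplanes are permuted by s i. *)
Definition mdequiv (d n : nat) (A B : mdmx bool d n) : Prop :=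
  exists (t : 'S_d) (s : 'I_d -> 'S_n),
    forall a : mdindex d n, B a = A [ffun i => s i (a (t i))].

(* Entry a of A changed to 1. *)
Definition add1_at (d n : nat) (A : mdmx bool d n) (a : mdindex d n) :
  mdmx bool d n := [ffun b => (b == a) || A b].

Section Polyplexes.
Variables (R : realType) (d n : nat).
Implicit Types (A : mdmx bool d n) (K : mdmx R d n) (L : 'M[R]_(d, n)).

Definition polyplex K (W : R) : Prop :=
  [/\ forall a, 0 <= K a,
      forall (i : 'I_d) (j : 'I_n), \sum_(a : mdindex d n | a i == j) K a <= 1
    & \sum_(a : mdindex d n) K a = W].

Definition polydiagonal K : Prop := polyplex K n%:R.

Definition contains A K : Prop := forall a, K a != 0 -> A a.

Definition extremal A : Prop :=
  ~ (exists K, polydiagonal K /\ contains A K) /\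
  forall a, ~~ A a -> exists K, polydiagonal K /\ contains (add1_at A a) K.

Definition max_polyplex_weight A (W : R) : Prop :=
  (exists K, polyplex K W /\ contains A K) /\
  forall K V, polyplex K V -> contains A K -> V <= W.

Definition has_deficiency A (delta : R) : Prop :=
  exists2 W, max_polyplex_weight A W & delta = n%:R - W.

Definition table_weight L : R := \sum_(i < d) \sum_(j < n) L i j.

Definition hyperplane_cover A L : Prop :=
  (forall i j, 0 <= L i j) /\
  forall a, A a -> 1 <= \sum_(i < d) L i (a i).

Definition optimal_cover A L : Prop :=
  hyperplane_cover A L /\
  forall M, hyperplane_cover A M -> table_weight L <= table_weight M.

Definition num_half L (i : 'I_d) : nat := #|[pred j : 'I_n | L i j == 2^-1]|.

Definition extremal_classes (delta : R) : set (set (mdmx bool d n)) :=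
  fun C => exists A,
    [/\ extremal A, has_deficiency A delta & C = mdequiv A].

End Polyplexes.

Arguments extremal R {d n} A.
Arguments extremal_classes {R} d n delta.

(* A Young diagram is given by the weakly decreasing list of the (positive)
   lengths of its rows. *)
Definition young_diagrams (cells max_rows : nat) : set (seq nat) :=
  fun y => [/\ sorted geq y, all (leq 1) y, sumn y = cells
             & (size y <= max_rows)%N].

(* Main.v *)
(** By linear programming duality, a (0,1)-matrix A contains a polyplex of weight
    W iff all its hyperplane covers weigh at least W.  Hence, for an extremal A
    with an optimal cover L of weight n - delta, indices of a 1 cost at least 1
    and all other indices cost at most 1 - delta.

    If delta = 1 the zeros cost 0, so A is a union of n - 1 hyperplanes, and the
    numbers of these in each direction determine A up to equivalence.  If
    delta = 1/2 this gap forces L to be half-integral; mixing two optimal covers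
    with weights 1/4 and 3/4 gives uniqueness, and moving the halves of one row
    to the other rows gives the row condition.

    Conversely, a half-integral L yields the matrix A of all indices of cost at
    least 1.  Any cover M of A is r + (1 - r) L + b, where r is the cost of a
    cheapest index avoiding the support of L and b is nonnegative off the halves
    of L and on sums of two halves in distinct rows; the row condition then
    bounds the weight of b from below. *)
Require Import Defs.
From mathcomp Require Import all_boot all_order all_algebra all_fingroup.
From mathcomp Require Import boolp classical_sets functions reals.
From mathcomp Require Import lra zify.

Set Implicit Arguments.
Unset Strict Implicit.
Unset Printing Implicit Defensive.

Import Order.TTheory GRing.Theory Num.Theory.
Local Open Scope ring_scope.

(** * Farkas' lemma *)

(* Induction on the number of functionals, valid in infinite dimension: if the
   tail does not suffice, some y violates it with a i y > 0, and projecting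
   along y onto the kernel of the head functional reduces to the tail. *)
Lemma farkas (R : realFieldType) (V : lmodType R) (I : eqType) (s : seq I)
    (a : I -> V -> R) (c : V -> R) :
  uniq s -> (forall i, scalar (a i)) -> scalar c ->
  (forall x, (forall i, i \in s -> a i x <= 0) -> c x <= 0) ->
  exists2 l : I -> R, forall i, 0 <= l i &
    forall x, c x = \sum_(i <- s) l i * a i x.
Proof.
elim: s a c => [|i0 s IHs] a c /= => [_ _ c_lin c_le0|].
  exists (fun=> 0) => // x; rewrite big_nil.
  have c0 : c 0 = 0 by have := c_lin (-1) 0 0; rewrite scaler0 addr0; lra.
  have cN : c (- x) = - c x.
    by have := c_lin (-1) x 0; rewrite addr0 scaleN1r c0 addr0 mulN1r.
  (* With no constraint, [c] is nonpositive at both [x] and [- x]. *)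
  apply/eqP; rewrite eq_le c_le0 // -oppr_le0 -cN c_le0 //.
case/andP=> i0s s_uniq a_lin c_lin c_le0.
have [c_le0s|] := pselect
    (forall x, (forall i, i \in s -> a i x <= 0) -> c x <= 0).
  have [l l_ge0 lE] := IHs a c s_uniq a_lin c_lin c_le0s.
  exists (fun i => if i == i0 then 0 else l i) => [i|x].
    by case: eqP.
  rewrite big_cons eqxx mul0r add0r lE; apply: eq_big_seq => i si.
  by case: eqP => // ii0; rewrite -ii0 si in i0s.
move=> /existsNP[y /not_implyP[y_le0 /negP]]; rewrite -ltNge => cy_gt0.
have ay_gt0 : 0 < a i0 y.
  rewrite ltNge; apply/negP => ay_le0; move: cy_gt0; rewrite ltNge => /negP; apply.
  by apply: c_le0 => i; rewrite inE => /predU1P[->|/y_le0].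
pose p (f : V -> R) x := f x - f y / a i0 y * a i0 x.
have p_lin f : scalar f -> scalar (p f).
  by move=> f_lin k u v; rewrite /p f_lin a_lin; lra.
have pE f x : scalar f -> p f x = f ((- (a i0 x / a i0 y)) *: y + x).
  by move=> f_lin; rewrite f_lin /p; lra.
have [||| l l_ge0 lE] := IHs (fun i => p (a i)) (p c) s_uniq.
- by move=> i; apply/p_lin/a_lin.
- exact: p_lin.
- move=> x x_le0; rewrite pE //; apply: c_le0 => i; rewrite inE.
  case/predU1P=> [->|si]; last by rewrite -pE // x_le0.
  by rewrite a_lin mulNr divfK ?gt_eqF // addNr.
(* Evaluation at [y] forces this multiplier; it is nonnegative because [c y > 0] while the tail
   functionals are nonpositive at [y]. *)
pose l0 := (c y - \sum_(i <- s) l i * a i y) / a i0 y.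
exists (fun i => if i == i0 then l0 else l i) => [i|x].
  case: eqP => // _; rewrite divr_ge0 ?(ltW ay_gt0) // subr_ge0.
  apply: le_trans (ltW cy_gt0); rewrite big_seq sumr_le0 // => j sj.
  by rewrite mulr_ge0_le0 // y_le0.
rewrite big_cons eqxx [X in _ = _ + X](_ : _ = \sum_(i <- s) l i * a i x).
  have := lE x; rewrite /p; under eq_bigr do rewrite mulrBr.
  rewrite sumrB => /eqP; rewrite subr_eq => /eqP->.
  rewrite /l0 [X in _ - X + _](_ : _ =
    (\sum_(i <- s) l i * a i y) / a i0 y * a i0 x); first by lra.
  by rewrite !mulr_suml; apply: eq_bigr => i _; rewrite !mulrA.
apply: eq_big_seq => i si.
by case: eqP => // ii0; rewrite -ii0 si in i0s.
Qed.

(** * Linear programming duality between polyplexes and hyperplane covers *)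

Section Duality.
Variables (R : realType) (d n : nat).
Implicit Types (A : mdmx bool d n) (K : mdmx R d n) (L M : 'M[R]_(d, n)).
Implicit Types (a b : mdindex d n).

Definition cost L a : R := \sum_(i < d) L i (a i).

Lemma costD L M a : cost (L + M) a = cost L a + cost M a.
Proof. by rewrite -big_split; apply: eq_bigr => i _; rewrite mxE. Qed.

Lemma costZ k L a : cost (k *: L) a = k * cost L a.
Proof. by rewrite mulr_sumr; apply: eq_bigr => i _; rewrite mxE. Qed.

Lemma cost_delta i j a : cost (delta_mx i j) a = (a i == j)%:R.
Proof.
rewrite /cost (bigD1 i) //= big1 ?addr0 => [|k ki]; rewrite mxE ?eqxx //.
by rewrite (negPf ki).
Qed.

Lemma table_weightD L M : table_weight (L + M) = table_weight L + table_weight M.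
Proof.
rewrite /table_weight -big_split; apply: eq_bigr => i _.
by rewrite -big_split; apply: eq_bigr => j _; rewrite mxE.
Qed.

Lemma table_weightZ k L : table_weight (k *: L) = k * table_weight L.
Proof.
rewrite /table_weight mulr_sumr; apply: eq_bigr => i _.
by rewrite mulr_sumr; apply: eq_bigr => j _; rewrite mxE.
Qed.

Lemma table_weight_delta i j : table_weight (delta_mx i j : 'M[R]_(d, n)) = 1.
Proof.
rewrite /table_weight (bigD1 i) //= [X in _ + X]big1 ?addr0 => [|k ki].
  rewrite (bigD1 j) //= big1 ?addr0 => [|l lj]; rewrite mxE ?eqxx //=.
  by rewrite (negPf lj).
by apply: big1 => l _; rewrite mxE (negPf ki).
Qed.

Lemma table_weight_ge0 L : (forall i j, 0 <= L i j) -> 0 <= table_weight L.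
Proof. by move=> L0; apply: sumr_ge0 => i _; apply: sumr_ge0. Qed.

Lemma sum_cost K L : \sum_a K a * cost L a =
  \sum_(i < d) \sum_(j < n) L i j * \sum_(a : mdindex d n | a i == j) K a.
Proof.
under eq_bigr do rewrite mulr_sumr.
rewrite exchange_big; apply: eq_bigr => i _ /=.
rewrite (partition_big (fun a => a i) predT) //=; apply: eq_bigr => j _.
by rewrite mulr_sumr; apply: eq_bigr => a /eqP->; rewrite mulrC.
Qed.

(** The sum of [K a * cost L a] lies between the two weights: covering bounds it below on the
    support of [K], the hyperplane sums of [K] bound it above. *)
Lemma weak_duality A K L (W : R) :
  polyplex K W -> contains A K -> hyperplane_cover A L -> W <= table_weight L.
Proof.
move=> [K_ge0 K_le1 <-] AK [L_ge0 AL].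
apply: (@le_trans _ _ (\sum_a K a * cost L a)).
  apply: ler_sum => a _; have [->|Ka] := eqVneq (K a) 0; first by rewrite mul0r.
  by rewrite ler_peMr // AL // AK.
rewrite sum_cost; apply: ler_sum => i _; apply: ler_sum => j _.
by rewrite ler_piMr.
Qed.

(* The duality theorem in homogeneous form: t is the homogenising variable of
   the covering constraints, and one further linear constraint is allowed. *)
Lemma cover_farkas A (p q p' q' : R) :
  (forall M t, (forall i j, 0 <= M i j) -> (forall a, A a -> t <= cost M a) ->
     p * t + q * table_weight M <= 0 -> p' * t + q' * table_weight M <= 0) ->
  exists K (v : R), [/\ forall a, 0 <= K a, contains A K, 0 <= v,
    \sum_a K a = p' - v * p &
    forall i j, \sum_(a : mdindex d n | a i == j) K a <= v * q - q'].
Proof.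
move=> Apq.
pose V : lmodType R := ('M[R]_(d, n) * R^o)%type.
pose I : finType := (mdindex d n + ('I_d * 'I_n) + unit)%type.
(* Covering constraints, nonnegativity of the table, and the extra constraint. The factor [A a]
   makes the first kind trivial at the zeros of [A]. *)
pose f (k : I) (x : V) : R := match k with
  | inl (inl a) => (A a)%:R * (x.2 - cost x.1 a)
  | inl (inr ij) => - x.1 ij.1 ij.2
  | inr _ => p * x.2 + q * table_weight x.1 end.
have f_lin k : scalar (f k).
  move=> u [M s] [N t]; rewrite /f; case: k => [[a|ij]|_] /=.
  - by rewrite costD costZ /GRing.scale /=; lra.
  - by rewrite !mxE; lra.
  - by rewrite table_weightD table_weightZ /GRing.scale /=; lra.
pose c (x : V) : R := p' * x.2 + q' * table_weight x.1.
have c_lin : scalar c.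
  move=> u [M s] [N t]; rewrite /c /= table_weightD table_weightZ.
  by rewrite /GRing.scale /=; lra.
have [|l l_ge0 lE] := @farkas R V I (enum I) f c (enum_uniq _) f_lin c_lin.
  case=> M t /= Mt; apply: Apq.
  - by move=> i j; rewrite -oppr_le0; apply: (Mt (inl (inr (i, j)))); rewrite mem_enum.
  - move=> a Aa; have := Mt (inl (inl a)); rewrite mem_enum /= Aa mul1r subr_le0.
    exact.
  - by have := Mt (inr tt); rewrite mem_enum /=; apply.
pose K : mdmx R d n := [ffun a => (A a)%:R * l (inl (inl a))].
pose v := l (inr tt).
have {}lE M t : p' * t + q' * table_weight M = \sum_a K a * (t - cost M a)
    - \sum_(ij : 'I_d * 'I_n) l (inl (inr ij)) * M ij.1 ij.2
    + v * (p * t + q * table_weight M).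
  have /= := lE (M, t); rewrite /c /= => ->.
  rewrite big_enum /= !big_sumType /=.
  rewrite (big_pred1 tt); last by case.
  congr (_ + _ + _).
    by apply: eq_bigr => a _; rewrite ffunE; lra.
  by rewrite -sumrN; apply: eq_bigr => ij _; rewrite mulrN.
exists K, v; split => //.
- by move=> a; rewrite ffunE mulr_ge0.
- by move=> a; rewrite ffunE; case: (A a) => //; rewrite mul0r eqxx.
- exact: l_ge0.
(* The zero table with [t = 1] isolates the total of [K]. *)
- have := lE 0 1.
  have -> : table_weight (0 : 'M[R]_(d, n)) = 0.
    by have := table_weightZ 0 0; rewrite scale0r mul0r.
  rewrite (_ : \sum_(a in mdindex d n) _ = \sum_a K a); last first.
    apply: eq_bigr => a _.
    have -> : cost 0 a = 0 by have := costZ 0 0 a; rewrite scale0r mul0r.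
    by rewrite subr0 mulr1.
  by rewrite [X in _ - X]big1 => [|ij _]; [lra | rewrite mxE mulr0].
(* A unit table with [t = 0] isolates one hyperplane sum, up to the nonnegative multiplier of that
   entry. *)
- move=> i j; have := lE (delta_mx i j) 0; rewrite table_weight_delta.
  rewrite (bigD1 (i, j)) //= !mxE !eqxx [X in _ - (_ + X)]big1 => [|[k m] kl].
    rewrite (_ : \sum_(a in mdindex d n) _ =
               - \sum_(a : mdindex d n | a i == j) K a).
      by rewrite /=; have := l_ge0 (inl (inr (i, j))); lra.
    rewrite [in RHS]big_mkcond -sumrN; apply: eq_bigr => a _.
    by rewrite cost_delta sub0r; case: eqP => _; rewrite ?mulrN1 ?oppr0 ?mulr0.
  by move: kl; rewrite mxE /= -pair_eqE /= => /negPf->; rewrite mulr0.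
Qed.

(** In homogeneous form, [0 <= t] implies [W * t <= table_weight M]. The multipliers give [K] of
    total [W + v] with hyperplane sums at most 1, and scaling by [W / (W + v)] brings the total down
    to [W]. *)
Lemma polyplex_of_cover_bound A (W : R) : 0 <= W ->
  (forall M, hyperplane_cover A M -> W <= table_weight M) ->
  exists K, polyplex K W /\ contains A K.
Proof.
move=> W_ge0 AW.
have [M t M_ge0 AM|K [v [K_ge0 AK v_ge0 Ksum Kle]]] :=
    @cover_farkas A (-1) 0 W (-1).
  rewrite mul0r addr0 mulN1r oppr_le0 le_eqVlt => /predU1P[<-|t_gt0].
    by have := table_weight_ge0 M_ge0; lra.
  have : W <= table_weight (t^-1 *: M).
    apply: AW; split => [i j|a Aa]; first by rewrite mxE mulr_ge0 // invr_ge0 ltW.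
    by rewrite -/(cost _ _) costZ ler_pdivlMl // mulr1 AM.
  by rewrite table_weightZ ler_pdivlMl //; lra.
have {}Ksum : \sum_a K a = W + v by rewrite Ksum; lra.
have {}Kle i j : \sum_(a : mdindex d n | a i == j) K a <= 1.
  by apply: le_trans (Kle i j) _; lra.
(* Here [W + v] may vanish, so the zero matrix serves instead. *)
have [W0|W_neq0] := eqVneq W 0.
  exists [ffun=> 0]; split => [|a]; last by rewrite ffunE eqxx.
  by split => [a|i j|]; rewrite ?ffunE // big1 // => a _; rewrite ffunE.
have W_gt0 : 0 < W by rewrite lt0r W_neq0.
pose k := W / (W + v).
have k_ge0 : 0 <= k by rewrite divr_ge0 ?addr_ge0.
have k_le1 : k <= 1 by rewrite ler_pdivrMr ?mul1r ?lerDl //; lra.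
exists [ffun a => k * K a]; split; last first.
  by move=> a; rewrite ffunE mulf_eq0 negb_or => /andP[_ /AK].
split => [a|i j|]; first by rewrite ffunE mulr_ge0.
  under eq_bigr do rewrite ffunE; rewrite -mulr_sumr.
  by rewrite mulr_ile1 // sumr_ge0.
under eq_bigr do rewrite ffunE; rewrite -mulr_sumr Ksum divfK //.
by rewrite gt_eqF //; lra.
Qed.

(** If no such cover exists, [table_weight M <= W * t] forces [t <= 0]. The multipliers then give
    [K] of total [1 + v * W] with hyperplane sums at most [v], and [K / v] is a polyplex of weight
    [W + 1 / v], which is too heavy. *)
Lemma cover_of_polyplex_bound A (W : R) : (0 < d)%N ->
  (forall K V, polyplex K V -> contains A K -> V <= W) ->
  exists M, hyperplane_cover A M /\ table_weight M <= W.
Proof.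
move=> d_gt0 AW; apply: contrapT => noM.
have [M t M_ge0 AM|K [v [K_ge0 AK v_ge0 Ksum Kle]]] :=
    @cover_farkas A (- W) 1 1 0.
  rewrite mul1r mul0r addr0 mul1r => Mt; rewrite leNgt; apply/negP => t_gt0.
  apply: noM; exists (t^-1 *: M); split.
    split => [i j|a Aa]; first by rewrite mxE mulr_ge0 // invr_ge0 ltW.
    by rewrite -/(cost _ _) costZ ler_pdivlMl // mulr1 AM.
  by rewrite table_weightZ ler_pdivrMl //; lra.
have {}Ksum : \sum_a K a = 1 + v * W by rewrite Ksum; lra.
have {}Kle i j : \sum_(a : mdindex d n | a i == j) K a <= v.
  by apply: le_trans (Kle i j) _; lra.
(* If [v = 0], the hyperplane sums in any one direction vanish and force [K = 0], against total
   1. *)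
have [v0|v_neq0] := eqVneq v 0.
  have : \sum_a K a = 0.
    apply: big1 => a _; apply/eqP; rewrite eq_le K_ge0 andbT -v0.
    apply: le_trans (Kle (Ordinal d_gt0) (a (Ordinal d_gt0))).
    by rewrite (bigD1 a) //= lerDl sumr_ge0.
  by rewrite Ksum v0 mul0r addr0 => /eqP; rewrite oner_eq0.
have v_gt0 : 0 < v by rewrite lt0r v_neq0.
have := AW [ffun a => v^-1 * K a] (v^-1 + W).
have vV_gt0 : 0 < v^-1 by rewrite invr_gt0.
suff Kp : polyplex [ffun a => v^-1 * K a] (v^-1 + W).
  move=> /(_ Kp); have KA : contains A [ffun a => v^-1 * K a].
    by move=> a; rewrite ffunE mulf_eq0 negb_or => /andP[_ /AK].
  by move=> /(_ KA); lra.
split => [a|i j|]; first by rewrite ffunE mulr_ge0 // ltW.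
  under eq_bigr do rewrite ffunE; rewrite -mulr_sumr.
  by rewrite ler_pdivrMl // mulr1.
by under eq_bigr do rewrite ffunE; rewrite -mulr_sumr Ksum mulrDr mulr1 mulKf.
Qed.

End Duality.

(** * Sums under pairwise constraints *)

(* A smallest negative value -beta of b can only be compensated from outside its
   own fibre, where b is at least beta; inside the fibre b is at least -beta. *)
Lemma sum_ge0_pairwise (R : realDomainType) (T I : finType) (S : {set T})
    (row : T -> I) (b : T -> R) :
  {in S &, forall v w, row v != row w -> 0 <= b v + b w} ->
  (forall i, (#|[set v in S | row v == i]|.*2 <= #|S|)%N) ->
  0 <= \sum_(v in S) b v.
Proof.
move=> bS rowS.
have [[v0 v0S]|S0] := pselect (exists v, v \in S); last first.
  by rewrite big_pred0 // => v; apply/negP => vS; apply: S0; exists v.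
have [v vS v_min] := arg_minP b v0S.
have [bv_ge0|bv_lt0] := leP 0 (b v).
  by apply: sumr_ge0 => w wS; apply: le_trans bv_ge0 (v_min w wS).
rewrite (bigID (fun w => row w == row v)) /=.
pose h := #|[set w in S | row w == row v]|.
have -> : \sum_(w in S | row w == row v) b w =
  \sum_(w in [set w in S | row w == row v]) b w by apply: eq_bigl => w; rewrite inE.
have -> : \sum_(w in S | row w != row v) b w =
  \sum_(w in [set w in S | row w != row v]) b w by apply: eq_bigl => w; rewrite inE.
have le1 : b v *+ h <= \sum_(w in [set w in S | row w == row v]) b w.
  by rewrite -sumr_const; apply: ler_sum => w; rewrite inE => /andP[/v_min].
pose h' := #|[set w in S | row w != row v]|.
have le2 : - b v *+ h' <= \sum_(w in [set w in S | row w != row v]) b w.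
  rewrite -sumr_const; apply: ler_sum => w; rewrite inE => /andP[wS wv].
  by rewrite -subr_ge0 opprK addrC bS // eq_sym.
have hh' : (h <= h')%N.
  have := rowS (row v); rewrite -/h.
  have -> : #|S| = (h + h')%N.
    rewrite -(cardsID [set w | row w == row v] S) /h /h'.
    by congr (_ + _)%N; apply: eq_card => w; rewrite !inE andbC.
  lia.
apply: le_trans (lerD le1 le2).
rewrite mulNrn -(subnKC hh') mulrnDr opprD addrA subrr add0r -mulNrn mulrn_wge0 //.
by rewrite oppr_ge0 ltW.
Qed.

(** * Extremal matrices, the cost gap and optimal covers *)

Section Structure.
Variables (R : realType) (d n : nat).
Hypothesis d_gt0 : (0 < d)%N.
Implicit Types (A : mdmx bool d n) (K : mdmx R d n) (L M : 'M[R]_(d, n)).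
Implicit Types (a b : mdindex d n).

Definition set_coord a (i : 'I_d) (j : 'I_n) : mdindex d n :=
  [ffun k => if k == i then j else a k].

Lemma cost_set_coord L a i j :
  cost L (set_coord a i j) = cost L a - L i (a i) + L i j.
Proof.
rewrite /cost (bigD1 i) //= [in RHS](bigD1 i) //= ffunE eqxx.
rewrite [X in _ + X](_ : _ = \sum_(k < d | k != i) L k (a k)); first by lra.
by apply: eq_bigr => k ki; rewrite ffunE (negPf ki).
Qed.

Lemma set_coord_neq a i j k : k != i -> set_coord a i j k = a k.
Proof. by move=> ki; rewrite ffunE (negPf ki). Qed.

Lemma table_weight_diag L : table_weight L = \sum_(j < n) cost L [ffun=> j].
Proof.
rewrite /table_weight exchange_big; apply: eq_bigr => j _.
by apply: eq_bigr => i _; rewrite ffunE.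
Qed.

(** The all-ones matrix contains a polydiagonal: a cover of it costs at least 1 on each of the [n]
    constant indices, and these partition the table into columns. *)
Lemma extremal_has_zero A : extremal R A -> exists a, ~~ A a.
Proof.
case=> noK _; apply: contrapT => /forallNP A1; apply: noK.
apply: polyplex_of_cover_bound => // M [_ AM].
rewrite table_weight_diag -[n in n%:R]card_ord -sumr_const.
by apply: ler_sum => j _; apply: AM; apply: contrapT => /negP; apply: A1.
Qed.

(** Raising one entry of [M] by the shortfall at [a] gives a cover of the matrix with [a] added.
    That matrix contains a polydiagonal, so the new weight is at least [n]. *)
Lemma cover_gap A M a : extremal R A -> hyperplane_cover A M ->
  table_weight M < n%:R -> ~~ A a -> cost M a <= 1 - (n%:R - table_weight M).
Proof.
move=> [_ extA] [M_ge0 AM] M_lt /extA[K [Kn KA]].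
pose i0 := Ordinal d_gt0; pose e := Num.max 0 (1 - cost M a).
have e_ge0 : 0 <= e by rewrite le_max lexx.
have : n%:R <= table_weight (M + e *: delta_mx i0 (a i0)).
  apply: weak_duality Kn KA _; split => [i j|b].
    by rewrite !mxE addr_ge0 // mulr_ge0.
  rewrite ffunE -/(cost _ _) costD costZ cost_delta => /orP[/eqP->|/AM Mb].
    by rewrite eqxx mulr1 -lerBlDl le_max lexx orbT.
  by apply: le_trans Mb _; rewrite lerDl mulr_ge0.
rewrite table_weightD table_weightZ table_weight_delta mulr1 /e maxEle.
by case: ifP; lra.
Qed.

(** Strong duality: every cover weighs at least the maximum polyplex weight, and some cover attains
    it. *)
Lemma deficiency_optimal A (delta : R) : has_deficiency A delta ->
  (exists L, optimal_cover A L) /\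
  forall L, optimal_cover A L -> table_weight L = n%:R - delta.
Proof.
case=> W [[K [KW AK]] Wmax] ->.
have W_le M : hyperplane_cover A M -> W <= table_weight M.
  exact: weak_duality KW AK.
have [M [AM MW]] := cover_of_polyplex_bound d_gt0 Wmax.
split; first by exists M; split => // N AN; apply: le_trans MW (W_le N AN).
move=> L [AL Lmin]; apply/eqP; rewrite subKr eq_le W_le // andbT.
exact: le_trans (Lmin M AM) MW.
Qed.

Lemma optimal_deficiency A L :
  optimal_cover A L -> has_deficiency A (n%:R - table_weight L).
Proof.
move=> [AL Lmin]; exists (table_weight L) => //; split.
  by apply: polyplex_of_cover_bound => //; apply: table_weight_ge0; case: AL.
by move=> K V KV AK; apply: weak_duality KV AK AL.
Qed.

Lemma extremal_of_covers A L : hyperplane_cover A L -> table_weight L < n%:R ->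
  (forall a M, ~~ A a -> hyperplane_cover (add1_at A a) M ->
     n%:R <= table_weight M) -> extremal R A.
Proof.
move=> AL Ln An; split=> [[K [Kn AK]]|a Aa].
  by have := weak_duality Kn AK AL; rewrite leNgt Ln.
by apply: polyplex_of_cover_bound => // M; apply: An.
Qed.

Definition half_integral L :=
  forall i j, [\/ L i j = 0, L i j = 2^-1 | L i j = 1].

Lemma half_integral_ge0 L i j : half_integral L -> 0 <= L i j.
Proof. by move=> /(_ i j)[]->; lra. Qed.

Lemma half_integral_cost L a : half_integral L -> cost L a < 1 -> cost L a <= 2^-1.
Proof.
move=> Lh; suff [k ->] : exists k : nat, cost L a = k%:R / 2.
  move=> k1; have : (k < 2)%N by rewrite -(ltr_nat R); lra.
  by rewrite ltnS -(ler_nat R); lra.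
rewrite /cost; elim/big_ind: _ => [|x y [k ->] [l ->]|i _].
- by exists 0%N; rewrite mul0r.
- by exists (k + l)%N; rewrite natrD mulrDl.
- by case: (Lh i (a i)) => ->; [exists 0%N|exists 1%N|exists 2%N]; lra.
Qed.

(** For nonnegative [L], the largest matrix covered by [L]; it is the extremal matrix recovered from
    its optimal cover. *)
Definition table_matrix L : mdmx bool d n := [ffun a => 1 <= cost L a].

Lemma table_matrix_cover L :
  (forall i j, 0 <= L i j) -> hyperplane_cover (table_matrix L) L.
Proof. by move=> L_ge0; split => // a; rewrite ffunE. Qed.

End Structure.

(** * From half-integral tables to extremal matrices *)

Section HalfIntegralTables.
Variables (R : realType) (d n : nat).
Hypothesis d_gt0 : (0 < d)%N.
Implicit Types (L M : 'M[R]_(d, n)) (a : mdindex d n).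

Definition halves L : {set 'I_d * 'I_n} := [set v | L v.1 v.2 == 2^-1].

Lemma card_halves_row L i : #|[set v in halves L | v.1 == i]| = num_half L i.
Proof.
have pair_inj : injective (fun j : 'I_n => (i, j)) by move=> j k [].
rewrite /num_half -(card_imset _ pair_inj); apply: eq_card => -[k j].
rewrite !inE /=; apply/idP/imsetP => [/andP[Lk /eqP ki]|].
  by exists j; rewrite ?inE -ki.
by case=> l; rewrite inE => Ll [-> ->]; rewrite Ll eqxx.
Qed.

Lemma card_halves L : #|halves L| = (\sum_(i < d) num_half L i)%N.
Proof.
rewrite -sum1_card (partition_big (fun v => v.1) predT) //=.
apply: eq_bigr => i _; rewrite -card_halves_row -sum1_card.
by apply: eq_bigl => v; rewrite inE.
Qed.

(** An index seen as a set of table cells, so that costs and table weights are sums over subsets of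
    one finite type. *)
Definition mdgraph a : {set 'I_d * 'I_n} := [set v | a v.1 == v.2].

Lemma cost_sum_graph M a : cost M a = \sum_(v in mdgraph a) M v.1 v.2.
Proof.
rewrite (eq_bigl (fun v => true && (a v.1 == v.2))) => [|v]; last by rewrite inE.
rewrite -(pair_big_dep predT (fun i j => a i == j) (fun i j => M i j)) /=.
by apply: eq_bigr => i _; rewrite (big_pred1 (a i)) // => j; rewrite eq_sym.
Qed.

Lemma table_weight_sum_pairs M : table_weight M = \sum_v M v.1 v.2.
Proof. by rewrite /table_weight pair_big. Qed.

(** Two halves in distinct directions would already cost 1. *)
Lemma card_halves_graph L a :
  half_integral L -> cost L a < 1 -> (#|halves L :&: mdgraph a| <= 1)%N.
Proof.
move=> Lh La; apply/card_le1_eqP => -[i j] [i' j']; rewrite !inE /=.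
move=> /andP[/eqP Lij /eqP aij] /andP[/eqP Lij' /eqP aij'].
have [ii'|ii'] := eqVneq i i'; first by rewrite -aij' -aij ii'.
suff : 1 <= cost L a by rewrite leNgt La.
rewrite /cost (bigD1 i) //= (bigD1 i') 1?eq_sym //= aij Lij aij' Lij'.
have : 0 <= \sum_(k < d | (k != i) && (k != i')) L k (a k).
  by apply: sumr_ge0 => k _; apply: half_integral_ge0.
lra.
Qed.

(* r is the least M-cost of an index at which L vanishes in every direction, and
   b is M minus the row minima of M over the zeros of L, minus (1 - r) L. *)
Lemma cover_residual L M :
  half_integral L -> (forall i, exists j, L i j = 0) -> (forall i j, 0 <= M i j) ->
  (forall a, 1 <= cost L a -> 1 <= cost M a) ->
  exists (r : R) (b : 'M[R]_(d, n)), [/\ 0 <= r,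
    forall a, cost M a = r + (1 - r) * cost L a + cost b a,
    forall i j, L i j != 2^-1 -> 0 <= b i j &
    {in halves L &, forall v w, v.1 != w.1 -> 0 <= b v.1 v.2 + b w.1 w.2}].
Proof.
move=> Lh L0 M_ge0 LM.
have [z0 z0L] := fin_all_exists L0.
have zP i : exists j, L i j = 0 /\ forall j', L i j' = 0 -> M i j <= M i j'.
  have z0P : [pred j | L i j == 0] (z0 i) by apply/eqP.
  have [j /eqP Lj j_min] := arg_minP (fun j => M i j) z0P.
  by exists j; split => // j' /eqP; apply: j_min.
have [z' z'P] := fin_all_exists zP; pose z : mdindex d n := [ffun i => z' i].
have Lz i : L i (z i) = 0 by rewrite ffunE; case: (z'P i).
have Mz i j : L i j = 0 -> M i (z i) <= M i j.
  by rewrite ffunE; case: (z'P i) => _; apply.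
have costLz : cost L z = 0 by apply: big1 => i _; apply: Lz.
pose r := cost M z.
pose b : 'M[R]_(d, n) := \matrix_(i, j) (M i j - M i (z i) - (1 - r) * L i j).
exists r, b; split.
- exact: sumr_ge0.
- move=> a; rewrite /cost mulr_sumr [in X in X + _ + _]/r /cost -!big_split /=.
  by apply: eq_bigr => i _; rewrite mxE; lra.
- move=> i j Lij; rewrite mxE; case: (Lh i j) => Lv.
  + by rewrite Lv mulr0 subr0 subr_ge0 Mz.
  + by rewrite Lv eqxx in Lij.
  (* Moving one coordinate of [z] to a 1 of [L] gives [L]-cost 1, hence [M]-cost at least 1. *)
  + rewrite Lv; have := LM (set_coord z i j); rewrite !cost_set_coord costLz Lz Lv -/r.
    by rewrite subr0 add0r lexx => /(_ isT); lra.
- move=> [i j] [i' j']; rewrite !inE /= => /eqP Lij /eqP Lij' ii'.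
  (* Likewise with two coordinates moved to halves. *)
  have := LM (set_coord (set_coord z i j) i' j').
  rewrite !cost_set_coord set_coord_neq 1?eq_sym // costLz !Lz Lij Lij' -/r.
  rewrite !mxE Lij Lij' => LMz; have {LMz} : 1 <= r - M i (z i) + M i j - M i' (z i') + M i' j'.
    by apply: LMz; lra.
  by lra.
Qed.

Section Residual.
Variables (L M : 'M[R]_(d, n)) (delta : R).
Hypothesis L_half : half_integral L.
Hypothesis L_zero : forall i, exists j, L i j = 0.
Hypothesis L_weight : table_weight L = n%:R - delta.
(** The predecessor leaves room for deleting one half, the one an index may pass through. It is
    truncated, so tables without halves, as in deficiency 1, satisfy the bound. *)
Hypothesis L_rows :
  forall i, ((num_half L i).*2 <= (\sum_(k < d) num_half L k).-1)%N.
Hypothesis M_ge0 : forall i j, 0 <= M i j.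
Hypothesis LM : forall a, 1 <= cost L a -> 1 <= cost M a.

(** The weight of [M] is [n - delta + r * delta] plus that of [b], and [b] has nonnegative sum off
    any [G] with at most one half. [G] empty gives the first bound. For the second with [r <= 1],
    [G] is the graph of [a], and [cost b a >= (1 - r) * (1 - cost L a) >= (1 - r) * delta]; if
    [r > 1], [G] empty suffices again. *)
Lemma residual_bound : 0 <= delta -> delta <= 1 ->
  n%:R - delta <= table_weight M /\
  forall a, cost L a < 1 -> cost L a <= 1 - delta -> 1 <= cost M a ->
    n%:R <= table_weight M.
Proof.
move=> delta_ge0 delta_le1.
have [r [b [r_ge0 bE b_ge0 b_half]]] := cover_residual L_half L_zero M_ge0 LM.
have wE : table_weight M = n%:R - delta + r * delta + table_weight b.
  rewrite table_weight_diag; under eq_bigr do rewrite bE.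
  rewrite !big_split /= -mulr_sumr -!table_weight_diag sumr_const card_ord.
  by rewrite L_weight -mulr_natl; lra.
have b_sum (G : {set 'I_d * 'I_n}) :
    (#|halves L :&: G| <= 1)%N -> 0 <= \sum_(v | v \notin G) b v.1 v.2.
  move=> hG; rewrite (bigID (fun v => v \in halves L)) /= addr_ge0 //; last first.
    by apply: sumr_ge0 => v /andP[_]; rewrite inE; apply: b_ge0.
  rewrite (eq_bigl (mem (halves L :\: G))) => [|v]; last by rewrite !inE.
  apply: (sum_ge0_pairwise (row := fun v => v.1)) => [v w|i].
    by rewrite !inE => /andP[_ Lv] /andP[_ Lw]; apply: b_half; rewrite inE.
  have := L_rows i; rewrite -card_halves -card_halves_row.
  have := cardsID G (halves L).
  have : (#|[set v in halves L :\: G | v.1 == i]| <=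
          #|[set v in halves L | v.1 == i]|)%N.
    by apply/subset_leq_card/fintype.subsetP => v; rewrite !inE => /andP[/andP[_ ->] ->].
  have arith p h x y H : (p <= h -> x + y = H -> h.*2 <= H.-1 -> x <= 1 ->
    p.*2 <= y)%N by lia.
  by move=> ph xy hH; apply: arith ph xy hH hG.
have rd : 0 <= r * delta by rewrite mulr_ge0.
split.
  have := b_sum finset.set0; rewrite finset.setI0 cards0 => /(_ isT).
  rewrite (eq_bigl predT) => [|v]; last by rewrite inE.
  by rewrite -table_weight_sum_pairs; lra.
move=> a La_lt La; rewrite bE => Ma.
have := b_sum (mdgraph a) (card_halves_graph L_half La_lt).
have := table_weight_sum_pairs b; rewrite (bigID (fun v => v \in mdgraph a)) /=.
rewrite -cost_sum_graph => wb b_ge.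
have [r_le1|r_gt1] := leP r 1; last first.
  have := b_sum finset.set0; rewrite finset.setI0 cards0 => /(_ isT).
  rewrite (eq_bigl predT) => [|v]; last by rewrite inE.
  rewrite -table_weight_sum_pairs => b0.
  have : 0 <= (r - 1) * delta by apply: mulr_ge0; lra.
  by lra.
have : 0 <= (1 - r) * (1 - delta - cost L a) by apply: mulr_ge0; lra.
by lra.
Qed.

End Residual.

(** Criterion shared by both deficiencies: [residual_bound] gives optimality for covers [M] of the
    matrix, and extremality for [M] covering one more index. *)
Lemma half_integral_extremal L (delta : R) :
  half_integral L -> (forall i, exists j, L i j = 0) ->
  table_weight L = n%:R - delta -> 0 < delta -> delta <= 1 ->
  (forall i, ((num_half L i).*2 <= (\sum_(k < d) num_half L k).-1)%N) ->
  (forall a, cost L a < 1 -> cost L a <= 1 - delta) ->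
  [/\ extremal R (table_matrix L), has_deficiency (table_matrix L) delta
    & optimal_cover (table_matrix L) L].
Proof.
move=> Lh L0 Lw delta_gt0 delta_le1 Lrows Lgap.
have LA : hyperplane_cover (table_matrix L) L.
  by apply: table_matrix_cover => i j; apply: half_integral_ge0.
have Lopt : optimal_cover (table_matrix L) L.
  split => // M [M_ge0 AM]; rewrite Lw.
  have [//|||] := residual_bound Lh L0 Lw Lrows M_ge0; [|exact: ltW|by []|by []].
  by move=> a La; apply: AM; rewrite ffunE.
split => //; last first.
  by have := optimal_deficiency Lopt; rewrite Lw subKr.
apply: extremal_of_covers LA _ _ => [|a M]; first by rewrite Lw; lra.
rewrite ffunE -ltNge => La [M_ge0 AM].
have [|||_ /(_ a La (Lgap a La))] := residual_bound Lh L0 Lw Lrows M_ge0; last 1 first.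
- by apply; apply: AM; rewrite ffunE eqxx.
- by move=> b Lb; apply: AM; rewrite !ffunE Lb orbT.
- exact: ltW.
- by [].
Qed.

Lemma half_deficiency_extremal L : half_integral L ->
  table_weight L = n%:R - 2^-1 ->
  (forall i : 'I_d, (num_half L i < \sum_(k < d | k != i) num_half L k)%N) ->
  [/\ extremal R (table_matrix L), has_deficiency (table_matrix L) (2^-1 : R)
    & optimal_cover (table_matrix L) L].
Proof.
move=> Lh Lw Lrows; apply: half_integral_extremal => //; try lra; last first.
- by move=> a La; have := half_integral_cost Lh La; lra.
- have arith x y : (x < y -> x.*2 <= (x + y).-1)%N by lia.
  by move=> i; rewrite (bigD1 (P := predT) i) //=; apply/arith/Lrows.
(* A row [i] without zeros weighs at least [n] minus half its number of halves; the other rows hold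
   more halves, so the total would exceed [n]. *)
move=> i; apply: contrapT => /forallNP L0.
pose row k : R := \sum_(j < n) L k j.
have rowE k : (num_half L k)%:R / 2 <= row k.
  rewrite /num_half -sum1_card natr_sum mulr_suml /row big_mkcond.
  apply: ler_sum => j _; rewrite inE.
  by case: (Lh k j) => ->; case: eqP; lra.
have rowi : n%:R - (num_half L i)%:R / 2 = row i.
  rewrite /num_half -sum1_card natr_sum mulr_suml /row big_mkcond.
  rewrite -[n in n%:R]card_ord -sumr_const -sumrB.
  apply: eq_bigr => j _; rewrite inE.
  by case: (Lh i j) => Lij; [by case: (L0 j)| |]; rewrite Lij; case: eqP; lra.
have : table_weight L = row i + \sum_(k < d | k != i) row k.
  by rewrite /table_weight (bigD1 i).
have : \sum_(k < d | k != i) (num_half L k)%:R / 2 <= \sum_(k < d | k != i) row k.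
  by apply: ler_sum => k _; apply: rowE.
rewrite -mulr_suml -natr_sum.
by have := Lrows i; rewrite -(ltr_nat R); lra.
Qed.

End HalfIntegralTables.

(** * Optimal covers in deficiency 1/2 *)

Section HalfDeficiency.
Variables (R : realType) (d n : nat).
Hypothesis d_gt0 : (0 < d)%N.
Implicit Types (A : mdmx bool d n) (L M : 'M[R]_(d, n)) (a : mdindex d n).

Lemma table_eq_of_le M L : (forall i j, M i j <= L i j) ->
  table_weight L <= table_weight M -> M = L.
Proof.
move=> ML wLM; apply/matrixP => i j; apply/eqP; rewrite eq_sym -subr_eq0.
have ML_ge0 k l : 0 <= L k l - M k l by rewrite subr_ge0.
have : \sum_k \sum_l (L k l - M k l) <= 0.
  under eq_bigr do rewrite sumrB.
  by rewrite sumrB subr_le0.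
rewrite (bigD1 i) //= (bigD1 j) //= => sum_le0.
have := ML_ge0 i j; rewrite eq_le => ->; rewrite andbT.
have : 0 <= \sum_(k < d | k != i) \sum_l (L k l - M k l).
  by apply: sumr_ge0 => k _; apply: sumr_ge0.
have : 0 <= \sum_(l < n | l != j) (L i l - M i l) by apply: sumr_ge0.
lra.
Qed.

Lemma table_weight_nat M : (forall i j, M i j = 0 \/ M i j = 1) ->
  exists k : nat, table_weight M = k%:R.
Proof.
move=> M01; exists (\sum_i \sum_j nat_of_bool (M i j == 1)%R)%N.
rewrite natr_sum; apply: eq_bigr => i _; rewrite natr_sum; apply: eq_bigr => j _.
by case: (M01 i j) => ->; rewrite ?eqxx // eq_sym oner_eq0.
Qed.

Section Optimal.
Variables (A : mdmx bool d n) (L : 'M[R]_(d, n)).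
Hypothesis A_ext : extremal R A.
Hypothesis L_opt : optimal_cover A L.
Hypothesis L_weight : table_weight L = n%:R - 2^-1.

Lemma not_nat_weight (k : nat) : k%:R != n%:R - 2^-1 :> R.
Proof.
apply/eqP => kn; have : (2 * k + 1 = 2 * n)%N; last by lia.
by apply/eqP; rewrite -(eqr_nat R) natrD !natrM; apply/eqP; lra.
Qed.

Lemma half_gap a : ~~ A a -> cost L a <= 2^-1.
Proof.
move=> Aa; have LA := L_opt.1.
by have := cover_gap d_gt0 A_ext LA _ Aa; rewrite L_weight => /(_ _); lra.
Qed.

Section Hybrid.
Variable z : mdindex d n.
Hypothesis z_min : forall i j, L i (z i) <= L i j.

Lemma argmin_cost : 0 <= cost L z /\ cost L z <= 2^-1.
Proof.
split; first by apply: sumr_ge0 => i _; case: L_opt.1.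
have [a Aa] := extremal_has_zero A_ext.
by apply: le_trans (half_gap Aa); apply: ler_sum => i _.
Qed.

(* Take a minimal set S of directions such that a on S and z off S is still the
   index of a 1: leaving out a direction of S lowers the cost from at least 1 to
   at most 1/2. *)
Lemma hybrid a : A a ->
  (exists i, 1 - cost L z <= L i (a i) - L i (z i)) \/
  cost L z = 0 /\ exists i k, [/\ i != k, 2^-1 <= L i (a i) - L i (z i)
                                & 2^-1 <= L k (a k) - L k (z k)].
Proof.
move=> Aa; have [c_ge0 c_le] := argmin_cost.
pose hyb (S : {set 'I_d}) : mdindex d n := [ffun i => if i \in S then a i else z i].
pose l i := L i (a i) - L i (z i).
have l_ge0 i : 0 <= l i by rewrite subr_ge0.
have hybE S : cost L (hyb S) = cost L z + \sum_(i in S) l i.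
  rewrite [X in _ + X]big_mkcond /cost -big_split /=; apply: eq_bigr => i _.
  by rewrite ffunE /l; case: ifP => _; lra.
have AT : [pred S | A (hyb S)] finset.setT.
  by rewrite /= (_ : hyb _ = a) //; apply/ffunP => i; rewrite ffunE inE.
have [S /minsetP[AS S_min] _] := minset_exists AT.
have costS : 1 <= cost L z + \sum_(i in S) l i.
  by rewrite -hybE; apply: L_opt.1.2.
have costS1 i : i \in S -> cost L z + \sum_(k in S :\ i) l k <= 2^-1.
  move=> iS; rewrite -hybE; apply: half_gap; apply/negP => ASi.
  have /finset.setP/(_ i) := S_min _ ASi (subD1set S i).
  by rewrite !inE eqxx iS.
have l_half i : i \in S -> 2^-1 <= l i.
  by move=> iS; have := costS1 i iS; rewrite (big_setD1 i) //= in costS; lra.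
have [S0|[i iS]] := set_0Vmem S; first by move: costS; rewrite S0 big_set0; lra.
have [Si0|[k kSi]] := set_0Vmem (S :\ i).
  left; exists i; move: costS; rewrite (big_setD1 i) //= Si0 big_set0 /l; lra.
have [ki kS] : k != i /\ k \in S by move: kSi; rewrite !inE => /andP.
right; split; last by exists i, k; rewrite eq_sym ki; split => //; apply: l_half.
(* Without [i] the cost is at most 1/2, and [k] alone accounts for that much, so nothing is left for
   [z]. *)
have := costS1 i iS; rewrite (big_setD1 k) //=.
have : 0 <= \sum_(m in (S :\ i) :\ k) l m by apply: sumr_ge0.
have := l_half k kS; lra.
Qed.

(* Otherwise the singletons of the previous lemma form an integral cover of
   weight at least n, and then L itself has weight at least n. *)
Lemma argmin_cost0 : cost L z = 0.
Proof.
have [c_ge0 c_le] := argmin_cost.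
have [//|c_neq0] := eqVneq (cost L z) 0; exfalso.
set c := cost L z in c_ge0 c_le c_neq0 *.
pose N : 'M[R]_(d, n) := \matrix_(i, j) (1 - c <= L i j - L i (z i))%R%:R.
have N_cover : hyperplane_cover A N.
  split => [i j|a Aa]; first by rewrite mxE.
  have [[i ai]|[/eqP]] := hybrid Aa; last by rewrite (negPf c_neq0).
  rewrite (bigD1 i) //= mxE ai lerDl; apply: sumr_ge0 => k _.
  by rewrite mxE.
have [k Nk] : exists k : nat, table_weight N = k%:R.
  by apply: table_weight_nat => i j; rewrite mxE; case: (_ <= _); [right|left].
(* An integer that is at least [n - 1/2]. *)
have wN : n%:R <= table_weight N.
  have := L_opt.2 N N_cover; rewrite L_weight Nk => nk.
  by rewrite ler_nat -ltnS -(ltr_nat R) -addn1 natrD; lra.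
(* Each entry of [L] is at least its row minimum, and exceeds it by at least [1 - c] on the cells of
   [N]. *)
have : n%:R * c + (1 - c) * table_weight N <= table_weight L.
  have -> : n%:R * c = \sum_(i < d) \sum_(j < n) L i (z i).
    by rewrite /c mulr_sumr; apply: eq_bigr => i _; rewrite sumr_const card_ord mulr_natl.
  rewrite -table_weightZ -big_split; apply: ler_sum => i _.
  rewrite -big_split; apply: ler_sum => j _ /=; rewrite !mxE.
  by case: (leP (1 - c)) => /=; have := z_min i j; lra.
have : 0 <= (1 - c) * (table_weight N - n%:R) by apply: mulr_ge0; lra.
by rewrite L_weight; lra.
Qed.

End Hybrid.

(** Rounding [L] down to 0, 1/2 or 1 keeps a cover, because by [hybrid] each index of a 1 meets one
    entry at least 1 or two entries at least 1/2. Optimality leaves no room for a decrease. *)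
Lemma optimal_half_integral : half_integral L.
Proof.
have [L_ge0 AL] := L_opt.1.
have [a0 _] := extremal_has_zero A_ext.
have zP i : exists j, forall j', L i j <= L i j'.
  have [j _ j_min] := arg_minP (P := predT) (fun j => L i j) (isT : predT (a0 i)).
  by exists j => j'; apply: j_min.
have [z' z'P] := fin_all_exists zP; pose z : mdindex d n := [ffun i => z' i].
have z_min i j : L i (z i) <= L i j by rewrite ffunE.
have c0 := argmin_cost0 z_min.
have Lz i : L i (z i) = 0.
  have /psumr_eq0P c0' := c0; apply: c0' => // k _; exact: L_ge0.
pose N : 'M[R]_(d, n) := \matrix_(i, j)
  (if 1 <= L i j then 1 else if 2^-1 <= L i j then 2^-1 else 0).
have N_ge0 i j : 0 <= N i j by rewrite mxE; do 2?[case: ifP => _]; lra.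
have N_le i j : N i j <= L i j by rewrite mxE; do 2?[case: ifP => // _].
suff N_cover : hyperplane_cover A N.
  rewrite -(table_eq_of_le N_le (L_opt.2 N N_cover)) => i j; rewrite mxE.
  by do 2?[case: ifP => _]; constructor.
split => // a Aa; have [[i]|[_ [i [k [ik]]]]] := hybrid z_min Aa; rewrite !Lz !subr0.
  rewrite c0 subr0 => ai; rewrite (bigD1 i) //= mxE ai lerDl.
  exact: sumr_ge0.
move=> ai ak; rewrite (bigD1 i) //= (bigD1 k) 1?eq_sym //=.
have : 0 <= \sum_(m < d | (m != i) && (m != k)) N m (a m) by apply: sumr_ge0.
rewrite !mxE ai ak; case: ifP; case: ifP; lra.
Qed.

(** Turn the halves of row [i] into 0 and all others into 1. This is still a cover, since an index
    relying on halves meets two in distinct rows. If row [i] held at least as many halves as the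
    rest, its weight would be an integer equal to [n - 1/2]. *)
Lemma optimal_rows i :
  (num_half L i < \sum_(k < d | k != i) num_half L k)%N.
Proof.
rewrite ltnNge; apply/negP => h_le.
have [L_ge0 AL] := L_opt.1; have Lh := optimal_half_integral.
pose N : 'M[R]_(d, n) :=
  \matrix_(k, j) (if L k j == 2^-1 then (k != i)%R%:R else L k j).
have N01 k j : N k j = 0 \/ N k j = 1.
  rewrite mxE; case: (Lh k j) => ->; case: eqP => H; try by exfalso; lra.
  - by left.
  - by case: (k == i); [left|right].
  - by right.
have N_ge0 k j : 0 <= N k j by case: (N01 k j) => ->.
have N_cover : hyperplane_cover A N.
  split => // a Aa.
  suff [k Nk] : exists k, N k (a k) = 1.
    by rewrite (bigD1 k) //= Nk lerDl; apply: sumr_ge0.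
  apply: contrapT => /forallNP noN.
  have L0 k : k != i -> L k (a k) = 0.
    move=> ki; have := noN k; rewrite mxE ki.
    by case: (Lh k (a k)) => ->; rewrite ?eqxx //; case: eqP.
  have := AL a Aa; rewrite (bigD1 i) //= big1 => [|k /L0 //].
  have := noN i; rewrite mxE; case: (Lh i (a i)) => ->; try lra.
  by case: eqP; lra.
have [k Nk] := table_weight_nat N01.
have wN : table_weight N <= table_weight L.
  have rowE m : \sum_j N m j = \sum_j L m j +
      (if m == i then - 2^-1 else 2^-1) * (num_half L m)%:R.
    rewrite /num_half -sum1_card natr_sum mulr_sumr [X in _ + X]big_mkcond.
    rewrite -big_split; apply: eq_bigr => j _; rewrite mxE inE.
    by case: (L m j =P 2^-1) => [->|_]; [case: (m =P i) => _|] => /=; lra.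
  rewrite /table_weight; under eq_bigr do rewrite rowE.
  rewrite big_split gerDl /= (bigD1 i) //= eqxx.
  under eq_bigr => m mi do rewrite (negPf mi).
  rewrite -mulr_sumr -natr_sum.
  by move: h_le; rewrite -(ler_nat R); lra.
have := L_opt.2 N N_cover; have := not_nat_weight k.
by rewrite L_weight Nk in wN *; rewrite eq_le wN => /negP.
Qed.

End Optimal.

Lemma half_optimal_unique A L M : extremal R A -> table_weight L = n%:R - 2^-1 ->
  optimal_cover A L -> optimal_cover A M -> L = M.
Proof.
move=> A_ext Lw L_opt M_opt.
have Mw : table_weight M = n%:R - 2^-1.
  apply/eqP; rewrite eq_le -Lw (M_opt.2 L L_opt.1) (L_opt.2 M M_opt.1) //.
(* Unequal weights are essential: 0 and 1 average to 1/2, whereas here distinct entries never mix to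
   a half-integral value. *)
pose N : 'M[R]_(d, n) := 4^-1 *: L + (3 / 4) *: M.
have Nw : table_weight N = n%:R - 2^-1.
  by rewrite table_weightD !table_weightZ Lw Mw; lra.
have N_opt : optimal_cover A N.
  split => [|N' AN']; last by rewrite Nw -Lw; apply: L_opt.2.
  have [[L_ge0 AL] _] := L_opt; have [[M_ge0 AM] _] := M_opt.
  split => [i j|a Aa]; first by rewrite !mxE; have := L_ge0 i j; have := M_ge0 i j; lra.
  rewrite -/(cost _ _) costD !costZ.
  by have := AL a Aa; have := AM a Aa; rewrite -!/(cost _ _); lra.
have Lh := optimal_half_integral A_ext L_opt Lw.
have Mh := optimal_half_integral A_ext M_opt Mw.
have Nh := optimal_half_integral A_ext N_opt Nw.
apply/matrixP => i j; have := Nh i j; rewrite !mxE.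
by case: (Lh i j) => ->; case: (Mh i j) => ->; case; lra.
Qed.

End HalfDeficiency.

(** * Equivalence and the numbers of full hyperplanes *)

Lemma perm_of_card (T : finType) (X Y : {set T}) : #|X| = #|Y| ->
  exists s : {perm T}, forall x, (s x \in X) = (x \in Y).
Proof.
move=> XY.
(* Both sets are listed before their complements; the permutation matches equal positions. *)
pose list (Z : {set T}) := enum Z ++ enum (~: Z).
have list_size Z : size (list Z) = #|T|.
  by rewrite size_cat -!cardE cardsC.
have list_uniq Z : uniq (list Z).
  rewrite cat_uniq !enum_uniq andbT /=.
  by apply/hasPn => x; rewrite !mem_enum inE.
have list_mem Z x : x \in list Z.
  by rewrite mem_cat !mem_enum inE orbN.
have index_lt x : (index x (list Y) < #|T|)%N.
  by rewrite -(list_size Y) index_mem.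
have s_inj : injective (fun x => nth x (list X) (index x (list Y))).
  move=> x y; rewrite (set_nth_default y) ?list_size // => /eqP.
  rewrite nth_uniq ?list_size // => /eqP ixy.
  by rewrite -(nth_index x (list_mem Y x)) ixy nth_index.
exists (perm s_inj) => x; rewrite permE nth_cat -cardE XY /list index_cat.
rewrite mem_enum; have [xY|xY] := boolP (x \in Y).
  have i_lt : (index x (enum Y) < #|Y|)%N by rewrite cardE index_mem mem_enum.
  by rewrite i_lt -(mem_enum X) mem_nth // -cardE XY.
rewrite -cardE ltnNge leq_addr /= addKn.
apply/negbTE; rewrite -finset.in_setC -(mem_enum (~: X)) mem_nth // -cardE.
have -> : #|~: X| = #|~: Y| by apply/eqP; rewrite -(eqn_add2l #|X|) {2}XY !cardsC.
by rewrite cardE index_mem mem_enum inE.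
Qed.

Section Equivalence.
Variables d n : nat.
Implicit Types (A B C : mdmx bool d n) (a : mdindex d n).

Lemma mdequiv_refl A : mdequiv A A.
Proof.
exists 1%g, (fun=> 1%g) => a; congr (A _).
by apply/ffunP => i; rewrite ffunE !perm1.
Qed.

Lemma mdequiv_sym A B : mdequiv A B -> mdequiv B A.
Proof.
move=> [t [s AB]]; exists t^-1%g, (fun k => (s (t^-1 k))^-1)%g => a.
rewrite AB; congr (A _); apply/ffunP => i.
by rewrite !ffunE permK permKV.
Qed.

Lemma mdequiv_trans A B C : mdequiv A B -> mdequiv B C -> mdequiv A C.
Proof.
move=> [t [s AB]] [t' [s' BC]].
exists (t * t')%g, (fun i => (s' (t i) * s i)%g) => a.
rewrite BC AB; congr (A _); apply/ffunP => i.
by rewrite !ffunE !permM.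
Qed.

Lemma mdequiv_class A B : mdequiv A B -> mdequiv A = mdequiv B.
Proof.
move=> AB; apply/funext => C; apply/propext.
by split; apply: mdequiv_trans => //; apply: mdequiv_sym.
Qed.

Definition full_hyperplanes A (i : 'I_d) : {set 'I_n} :=
  [set j | [forall a : mdindex d n, (a i == j) ==> A a]].

Lemma full_hyperplanesP A i j :
  reflect (forall a : mdindex d n, a i = j -> A a) (j \in full_hyperplanes A i).
Proof.
rewrite inE; apply: (iffP forallP) => [Aj a aij|Aj a].
  by apply: (implyP (Aj a)); apply/eqP.
by apply/implyP => /eqP; apply: Aj.
Qed.

Definition full_numbers A : seq nat :=
  [seq #|full_hyperplanes A i| | i <- enum 'I_d].

Definition young_of A : seq nat := sort geq [seq m <- full_numbers A | (0 < m)%N].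

Lemma geq_total : total geq. Proof. by move=> x y; exact: leq_total. Qed.

Lemma geq_trans : transitive geq.
Proof. by move=> y x z /= yx zy; apply: leq_trans zy yx. Qed.

Lemma geq_anti : antisymmetric geq.
Proof. by move=> x y /= xy; apply: anti_leq; rewrite andbC. Qed.

(** The zeros dropped by [young_of] can be restored, since both lists have length [d]. *)
Lemma young_of_perm A B :
  (young_of A = young_of B) <-> perm_eq (full_numbers A) (full_numbers B).
Proof.
split=> [/(perm_sortP geq_total geq_trans geq_anti) AB|AB]; last first.
  by apply/(perm_sortP geq_total geq_trans geq_anti)/perm_filter.
rewrite -(perm_filterC (fun m => 0 < m)%N (full_numbers A)) perm_sym.
rewrite -(perm_filterC (fun m => 0 < m)%N (full_numbers B)).
have zeros C : [seq m <- full_numbers C | predC (fun m => 0 < m)%N m] =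
    nseq (d - size [seq m <- full_numbers C | (0 < m)%N]) 0%N.
  have -> : d = size (full_numbers C) by rewrite size_map size_enum_ord.
  elim: (full_numbers C) => //= -[|m] l -> /=; last by rewrite subSS.
  by rewrite subSn // size_filter count_size.
by rewrite !zeros (perm_size AB) perm_cat2r perm_sym.
Qed.

Lemma mdequiv_young A B : mdequiv A B -> young_of A = young_of B.
Proof.
move=> [t [s AB]]; apply/young_of_perm.
(* [s i] maps the full hyperplanes of [B] in direction [t i] onto those of [A] in direction [i]. *)
have fullE i : #|full_hyperplanes A i| = #|full_hyperplanes B (t i)|.
  rewrite -(card_preimset (full_hyperplanes A i) (@perm_inj _ (s i))).
  apply: eq_card => j; rewrite finset.in_set.
  apply/full_hyperplanesP/full_hyperplanesP => [Aj a aj|Bj b bj].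
    by rewrite AB; apply: Aj; rewrite ffunE aj.
  pose a : mdindex d n := [ffun k => ((s (t^-1 k))^-1 (b (t^-1 k)))%g].
  have := Bj a; rewrite AB ffunE permK bj permK => /(_ erefl).
  by congr (is_true (A _)); apply/ffunP => k; rewrite !ffunE permK permKV.
rewrite /full_numbers (eq_map fullE) (map_comp (fun i => #|full_hyperplanes B i|) t).
apply: perm_map; apply: uniq_perm.
- by rewrite (map_inj_uniq (@perm_inj _ t)) enum_uniq.
- exact: enum_uniq.
- move=> i; rewrite mem_enum; apply/mapP.
  by exists (t^-1 i)%g; rewrite ?mem_enum ?permKV.
Qed.

Definition union_of_hyperplanes A :=
  forall a, A a = [exists i, a i \in full_hyperplanes A i].

(** Equal counts up to order give the permutation [t] of directions; within each direction, sets of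
    equal size are matched by [perm_of_card]. *)
Lemma young_mdequiv A B : union_of_hyperplanes A -> union_of_hyperplanes B ->
  young_of A = young_of B -> mdequiv A B.
Proof.
move=> Au Bu /young_of_perm fAB.
have /tuple_permP[t AB] :
  perm_eq (full_numbers A) [tuple #|full_hyperplanes B i| | i < d] := fAB.
have {}AB i : #|full_hyperplanes A i| = #|full_hyperplanes B (t i)|.
  have := congr1 (fun l => nth 0%N l i) AB.
  rewrite (nth_map i) ?size_enum_ord // nth_ord_enum => ->.
  by rewrite (nth_map i) ?size_enum_ord // nth_ord_enum tnth_mktuple.
have [s sP] := fin_all_exists (fun i => perm_of_card (AB i)).
exists t, s => a; rewrite Au Bu; apply/existsP/existsP => -[i ai].
  by exists (t^-1 i)%g; rewrite ffunE sP permKV.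
by exists (t i); rewrite -sP; rewrite ffunE in ai.
Qed.

End Equivalence.

(** * Deficiency 1 and Young diagrams *)

Section DeficiencyOne.
Variables (R : realType) (d n : nat).
Hypotheses (d_gt0 : (0 < d)%N) (n_gt0 : (0 < n)%N).
Implicit Types (A : mdmx bool d n) (a : mdindex d n).

Lemma sumn_full_numbers A :
  sumn (full_numbers A) = (\sum_(i < d) #|full_hyperplanes A i|)%N.
Proof. by rewrite sumnE big_map big_enum. Qed.

(** Zeros cost 0, so a positive entry of an optimal [L] marks a full hyperplane, and these cover
    [A]. Conversely full hyperplanes have entries at least 1. Their indicator table is thus a cover
    below [L], hence equal to it, and its weight counts them. *)
Lemma deficiency1_structure A : extremal R A -> has_deficiency A (1 : R) ->
  union_of_hyperplanes A /\ sumn (full_numbers A) = n.-1.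
Proof.
move=> A_ext A_def.
have [[L L_opt] /(_ L L_opt) Lw] := deficiency_optimal d_gt0 A_def.
have [L_ge0 AL] := L_opt.1.
have gap a : ~~ A a -> cost L a <= 0.
  move=> Aa; have := cover_gap d_gt0 A_ext L_opt.1 _ Aa.
  by rewrite Lw => /(_ _); lra.
have L_le_cost a i : L i (a i) <= cost L a.
  by rewrite /cost (bigD1 i) //= lerDl; apply: sumr_ge0.
have A_pos a : 0 < cost L a -> A a.
  by move=> La; apply: contraLR La => /gap; rewrite -leNgt.
have full_pos i j : 0 < L i j -> j \in full_hyperplanes A i.
  move=> Lij; apply/full_hyperplanesP => a aij; apply: A_pos.
  by apply: lt_le_trans Lij _; rewrite -aij.
have A_union : union_of_hyperplanes A.
  move=> a; apply/idP/existsP => [Aa|[i /full_hyperplanesP]]; last exact.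
  apply: contrapT => /forallNP noi.
  have := AL a Aa; rewrite big1 ?ler10 // => i _; apply/eqP.
  rewrite eq_le L_ge0 andbT leNgt; apply/negP => /full_pos.
  exact: noi.
split => //.
have [a0 Aa0] := extremal_has_zero A_ext.
have La0 : cost L a0 = 0.
  by apply/eqP; rewrite eq_le gap //=; apply: sumr_ge0.
(* An index of cost 0 moved into the full hyperplane pays only [L i j]. *)
have L_full i j : j \in full_hyperplanes A i -> 1 <= L i j.
  move=> /full_hyperplanesP/(_ (set_coord a0 i j)); rewrite ffunE eqxx.
  move=> /(_ erefl)/AL; rewrite -/(cost _ _) cost_set_coord La0.
  by have := L_ge0 i (a0 i); lra.
pose N : 'M[R]_(d, n) := \matrix_(i, j) (j \in full_hyperplanes A i)%:R.
have N_ge0 i j : 0 <= N i j by rewrite mxE.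
have NL i j : N i j <= L i j.
  by rewrite mxE; case: (boolP (j \in _)) => [/L_full|] //; rewrite L_ge0.
have N_cover : hyperplane_cover A N.
  split => // a; rewrite A_union => /existsP[i ai].
  by rewrite (bigD1 i) //= mxE ai lerDl; apply: sumr_ge0.
have := Lw; rewrite -(table_eq_of_le NL (L_opt.2 N N_cover)).
have -> : table_weight N = (sumn (full_numbers A))%:R.
  rewrite sumn_full_numbers natr_sum; apply: eq_bigr => i _.
  by rewrite -sum1_card natr_sum [RHS]big_mkcond; apply: eq_bigr => j _; rewrite mxE; case: (_ \in _).
by rewrite -(natrB _ n_gt0) => /eqP; rewrite eqr_nat subn1 => /eqP.
Qed.

Lemma young_of_diagram A : sumn (full_numbers A) = n.-1 ->
  young_diagrams n.-1 d (young_of A).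
Proof.
move=> An; split.
- exact: sort_sorted geq_total _.
- by rewrite all_sort; apply: filter_all.
- rewrite -An /young_of (perm_sumn (permEl (perm_sort _ _))).
  by elim: (full_numbers A) => //= -[|m] l IHl //=; rewrite IHl.
- by rewrite size_sort size_filter (leq_trans (count_size _ _)) // size_map size_enum_ord.
Qed.

Lemma young_realized (y : seq nat) : young_diagrams n.-1 d y ->
  exists A, [/\ extremal R A, has_deficiency A (1 : R) & young_of A = y].
Proof.
move=> [y_sorted y_pos y_sum y_size].
have y_eq : [seq nth 0%N y (i : 'I_d) | i : 'I_d <- enum 'I_d] = y ++ nseq (d - size y) 0%N.
  apply: (@eq_from_nth _ 0%N) => [|i].
    by rewrite size_cat size_nseq subnKC // size_map size_enum_ord.
  rewrite size_map size_enum_ord => i_lt.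
  rewrite (nth_map (Ordinal i_lt)) ?size_enum_ord // nth_enum_ord // nth_cat.
  by case: ltnP => // i_ge; rewrite nth_nseq if_same nth_default.
have y_tot : (\sum_(i < d) nth 0%N y i = n.-1)%N.
  rewrite -y_sum; transitivity (sumn [seq nth 0%N y (i : 'I_d) | i : 'I_d <- enum 'I_d]).
    by rewrite sumnE big_map big_enum.
  by rewrite y_eq sumn_cat sumn_nseq mul0n addn0.
have y_lt (i : 'I_d) : (nth 0%N y i < n)%N.
  rewrite -(prednK n_gt0) ltnS -y_tot (bigD1 i) //=; exact: leq_addr.
(* The first [y_i] hyperplanes of direction [i] are taken, with [y] padded by zeros. Every [y_i] is
   at most [n - 1], so the last hyperplane [j0] is always free. *)
pose L : 'M[R]_(d, n) := \matrix_(i, j) (j < nth 0%N y i)%N%:R.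
have j0_lt : (n.-1 < n)%N by rewrite prednK.
pose j0 := Ordinal j0_lt.
have L0 i : L i j0 = 0.
  by rewrite mxE /= ltnNge -ltnS prednK ?y_lt.
have Lh : half_integral L.
  by move=> i j; rewrite mxE; case: (_ < _)%N; constructor.
have no_half i : num_half L i = 0%N.
  apply: eq_card0 => j; rewrite inE mxE; apply/eqP.
  by case: (_ < _)%N => /=; lra.
have Lw : table_weight L = n%:R - 1.
  rewrite -(natrB _ n_gt0) subn1 -y_tot natr_sum; apply: eq_bigr => i _.
  under eq_bigr do rewrite mxE.
  rewrite -natr_sum; congr (_%:R).
  rewrite -{2}(card_ord (nth 0%N y i)) -sum1_card.
  rewrite (big_ord_widen n (fun=> 1%N)) ?(ltnW (y_lt i)) //.
  by rewrite [RHS]big_mkcond; apply: eq_bigr => j _; case: (_ < _)%N.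
have [|||||A_ext A_def _] := half_integral_extremal d_gt0 (delta := 1) Lh _ Lw.
- by move=> i; exists j0.
- exact: ltr01.
- exact: lexx.
- by move=> i; rewrite no_half.
- move=> a La; rewrite subrr; rewrite /cost big1 // => i _.
  rewrite mxE; case: ltnP => // ai; suff : 1 <= cost L a by rewrite leNgt La.
  rewrite /cost (bigD1 i) //= mxE ai lerDl; apply: sumr_ge0 => k _.
  exact: half_integral_ge0.
exists (table_matrix L); split => //.
have fullE i : #|full_hyperplanes (table_matrix L) i| = nth 0%N y i.
  transitivity #|[pred j : 'I_n | (j < nth 0%N y i)%N]|.
    apply: eq_card => j; rewrite [RHS]inE; apply/full_hyperplanesP/idP => [Lj|j_lt a aij].
      (* The index equal to [j0] outside direction [i] costs exactly [L i j]. *)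
      have := Lj (set_coord [ffun=> j0] i j); rewrite !ffunE eqxx => /(_ erefl).
      rewrite cost_set_coord ffunE L0 subr0 /cost big1 => [|k _]; last by rewrite ffunE.
      by rewrite add0r mxE; case: (_ < _)%N => //; rewrite ler10.
    rewrite ffunE /cost (bigD1 i) //= mxE aij j_lt lerDl; apply: sumr_ge0 => k _.
    exact: half_integral_ge0.
  rewrite -sum1_card -[RHS]card_ord -sum1_card.
  by rewrite [RHS](big_ord_widen n (fun=> 1%N)) ?(ltnW (y_lt i)).
rewrite /young_of /full_numbers (eq_map fullE) y_eq filter_cat.
rewrite (all_filterP y_pos) (_ : [seq m <- nseq _ _ | _] = [::]); last first.
  by elim: (d - size y)%N.
by rewrite cats0; apply: sorted_sort geq_trans _ _.
Qed.

Lemma young_bijection : exists f : set (mdmx bool d n) -> seq nat,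
  set_bij (extremal_classes d n (1 : R)) (young_diagrams n.-1 d) f.
Proof.
(* Any representative will do, by [mdequiv_young]; the default matrix is returned only for the empty
   set, which is no class. *)
pose f (C : set (mdmx bool d n)) := young_of (xget [ffun=> false] C).
have fE A : f (mdequiv A) = young_of A.
  apply/esym/mdequiv_young/(@xgetPex _ [ffun=> false] (mdequiv A)).
  by exists A; apply: mdequiv_refl.
exists f; split.
- move=> _ [A [A_ext A_def ->]]; rewrite fE; apply: young_of_diagram.
  by case: (deficiency1_structure A_ext A_def).
- move=> C D; rewrite !inE => -[A [A_ext A_def ->]] [B [B_ext B_def ->]].
  rewrite !fE => AB; apply: mdequiv_class; apply: young_mdequiv AB.
    by case: (deficiency1_structure A_ext A_def).
  by case: (deficiency1_structure B_ext B_def).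
- move=> y /young_realized[A [A_ext A_def Ay]].
  by exists (mdequiv A); [exists A|rewrite fE].
Qed.

End DeficiencyOne.

Theorem theorem6p7 (R : realType) (d n : nat)
    (d_gt0 : (0 < d)%N) (n_gt0 : (0 < n)%N) :
  (exists f : set (mdmx bool d n) -> seq nat,
     set_bij (extremal_classes d n (1 : R)) (young_diagrams n.-1 d) f)
  /\
  ((forall A : mdmx bool d n, extremal R A -> has_deficiency A (2^-1 : R) ->
      exists! L : 'M[R]_(d, n), optimal_cover A L)
   /\
   forall L : 'M[R]_(d, n), (forall i j, 0 <= L i j) ->
     (exists A : mdmx bool d n,
        [/\ extremal R A, has_deficiency A (2^-1 : R) & optimal_cover A L])
     <->
     [/\ forall i j, [\/ L i j = 0, L i j = 2^-1 | L i j = 1],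
         table_weight L = n%:R - 2^-1
       & forall i : 'I_d,
           (num_half L i < \sum_(k < d | k != i) num_half L k)%N]).
Proof.
split; first exact: young_bijection.
split=> [A A_ext A_def|L L_ge0].
  have [[L L_opt] /(_ L L_opt) Lw] := deficiency_optimal d_gt0 A_def.
  exists L; split=> // M M_opt.
  exact: (half_optimal_unique d_gt0 A_ext Lw L_opt M_opt).
split=> [[A [A_ext A_def L_opt]]|[L_half L_weight L_rows]].
  have [_ /(_ L L_opt) Lw] := deficiency_optimal d_gt0 A_def.
  split=> // [|i]; first exact: (optimal_half_integral d_gt0 A_ext L_opt Lw).
  exact: (optimal_rows d_gt0 A_ext L_opt Lw).
by exists (table_matrix L); apply: half_deficiency_extremal.
Qed.
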